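(* Let $\pi\colon U\to B$ be a field. The following statements are equivalent: (i) $\pi$ is an ultimate Urysohn field. (ii) $\pi$ is a Urysohn field over $B$ and $B$ is a Urysohn space. (iii) $\pi$ is a strongly universal field and every finite isometric double matching of $\pi$ can be extended to a double automorphism of $\pi$.
   Context: A Polish space means a complete separable metric space. A field (or $B$-field) is a $1$-Lipschitz map $\pi\colon X\to B$ where $X$ and $B$ are Polish spaces. A one-point extension of a metric space $A$ is a metric space $A^\ast=A\sqcup\{a^\ast\}$ whose metric restricts to the given one on $A$. Isometric embeddings are distance-preserving maps, not necessarily surjective. Finite subspaces may be empty. Universal space: a Polish space into which every Polish space embeds isometrically. Urysohn space: a universal Polish space $X$ such that every bijective isometry between finite subsets of $X$ extends to a bijective isometry of $X$ onto itself. A $B$-field $\pi\colon U\to B$ is $B$-universal if for any $B$-field $\phi\colon Y\to B$ there is an isometric embedding $\imath\colon Y\to U$ with $\pi\circ\imath=\phi$. It is strongly universal if it is $B$-universal and $B$ is a universal space. A $B$-field $\pi\colon U\to B$ is a Urysohn field over $B$ if for each finite subspace $A\subseteq U$ and each $1$-Lipschitz map $\phi\colon A^\ast\to B$ on a one-point extension $A^\ast=A\sqcup\{a^\ast\}$ with $\phi|_A=\pi|_A$, there is an isometric embedding $\imath\colon A^\ast\to U$ such that $\imath|_A$ is the inclusion and $\pi\circ\imath=\phi$. A field $\pi\colon U\to B$ is an ultimate Urysohn field if for any finite subspaces $A\subseteq U$ and $Z\subseteq B$ with $\pi(A)\subseteq Z$, any one-point extensions $A^\ast$ of $A$ and $Z^\ast$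 of $Z$, and any $1$-Lipschitz map $p\colon A^\ast\to Z^\ast$ with $p|_A=\pi|_A$, there exist isometric embeddings $\imath\colon A^\ast\to U$ and $\jmath\colon Z^\ast\to B$ such that $\imath|_A$ and $\jmath|_Z$ are the inclusion maps and $\pi\circ\imath=\jmath\circ p$. A double automorphism of $\pi\colon U\to B$ is a pair of bijective isometries $\varphi\colon U\to U$, $\psi\colon B\to B$ with $\pi\circ\varphi=\psi\circ\pi$. An isometric double matching of $\pi$ is a pair of bijective isometries $\phi\colon A\to A'$ between subspaces of $U$ and $\theta\colon Z\to Z'$ between subspaces of $B$ such that $\pi(A)\subseteq Z$, $\pi(A')\subseteq Z'$ and $\pi|_{A'}\circ\phi=\theta\circ\pi|_A$; it is finite if $A,A',Z,Z'$ are finite. A double automorphism $(\varphi,\psi)$ extends $(\phi,\theta)$ if $\varphi|_A=\phi$ and $\psi|_Z=\theta$. *)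

(* Defs.v *)
From HB Require Import structures.
From mathcomp Require Import all_boot all_order all_algebra.
From mathcomp Require Import all_classical all_reals topology.

Set Implicit Arguments.
Unset Strict Implicit.
Unset Printing Implicit Defensive.

Import Order.TTheory GRing.Theory Num.Theory.

Local Open Scope classical_set_scope.
Local Open Scope ring_scope.

(* The library's [completeType] is pointed, which would exclude the empty
   space; these are the same conditions on a possibly empty space. *)
Definition complete_space (T : uniformType) : Prop :=
  forall F : set_system T, ProperFilter F -> cauchy F -> exists x : T, F --> x.

Definition separable_space (T : topologicalType) : Prop :=
  exists2 D : set T, countable D & dense D.

Definition polish (R : realType) (X : metricType R) : Prop :=
  complete_space X /\ separable_space X.

Definition isometric_embedding (R : realType) (X Y : metricType R)
    (f : X -> Y) : Prop :=
  forall x y : X, mdist (f x) (f y) = mdist x y.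

(* Bijective isometries between subspaces are represented by total functions
   of which only the values on [A] matter. *)
Definition bijective_isometry (R : realType) (X Y : metricType R)
    (A : set X) (B : set Y) (f : X -> Y) : Prop :=
  set_bij A B f /\
  forall x y : X, A x -> A y -> mdist (f x) (f y) = mdist x y.

Definition one_lipschitz (R : realType) (X Y : metricType R)
    (f : X -> Y) : Prop :=
  forall x y : X, mdist (f x) (f y) <= mdist x y.

(* The metric space A* = A + {a*}; [ext_incl] is the inclusion of A in A*. *)
Record one_point_extension (R : realType) (X : metricType R) (A : set X) := {
  ext_space :> metricType R ;
  ext_incl : A -> ext_space ;
  ext_point : ext_space ;
  ext_inclE : forall x y : A,
    mdist (ext_incl x) (ext_incl y) = mdist (val x) (val y) ;
  ext_point_new : forall x : A, ext_incl x <> ext_point ;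
  ext_cover : forall e : ext_space,
    e = ext_point \/ exists x : A, e = ext_incl x
}.

Definition universal_space (R : realType) (X : metricType R) : Prop :=
  polish X /\
  forall Y : metricType R, polish Y ->
    exists f : Y -> X, isometric_embedding f.

Definition urysohn_space (R : realType) (X : metricType R) : Prop :=
  universal_space X /\
  forall (A A' : set X) (f : X -> X),
    finite_set A -> finite_set A' -> bijective_isometry A A' f ->
    exists g : X -> X, bijective_isometry [set: X] [set: X] g /\
      forall x : X, A x -> g x = f x.

Definition is_field (R : realType) (X B : metricType R) (p : X -> B) : Prop :=
  [/\ polish X, polish B & one_lipschitz p].

Definition universal_field (R : realType) (U B : metricType R)
    (p : U -> B) : Prop :=
  is_field p /\
  forall (Y : metricType R) (phi : Y -> B), is_field phi ->
    exists i : Y -> U, isometric_embedding i /\ forall y : Y, p (i y) = phi y.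

Definition strongly_universal_field (R : realType) (U B : metricType R)
    (p : U -> B) : Prop :=
  universal_field p /\ universal_space B.

Definition urysohn_field (R : realType) (U B : metricType R)
    (p : U -> B) : Prop :=
  is_field p /\
  forall (A : set U) (Aext : one_point_extension A) (phi : Aext -> B),
    finite_set A -> one_lipschitz phi ->
    (forall x : A, phi (ext_incl Aext x) = p (val x)) ->
    exists i : Aext -> U,
      [/\ isometric_embedding i,
          forall x : A, i (ext_incl Aext x) = val x &
          forall e : Aext, p (i e) = phi e].

Definition ultimate_urysohn_field (R : realType) (U B : metricType R)
    (p : U -> B) : Prop :=
  is_field p /\
  forall (A : set U) (Z : set B)
         (Aext : one_point_extension A) (Zext : one_point_extension Z)
         (q : Aext -> Zext),
    finite_set A -> finite_set Z -> p @` A `<=` Z ->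
    one_lipschitz q ->
    (forall (x : A) (z : Z), val z = p (val x) ->
      q (ext_incl Aext x) = ext_incl Zext z) ->
    exists (i : Aext -> U) (j : Zext -> B),
      [/\ isometric_embedding i, isometric_embedding j,
          forall x : A, i (ext_incl Aext x) = val x,
          forall z : Z, j (ext_incl Zext z) = val z &
          forall e : Aext, p (i e) = j (q e)].

Definition double_automorphism (R : realType) (U B : metricType R)
    (p : U -> B) (phi : U -> U) (psi : B -> B) : Prop :=
  [/\ bijective_isometry [set: U] [set: U] phi,
      bijective_isometry [set: B] [set: B] psi &
      forall x : U, p (phi x) = psi (p x)].

Definition double_matching (R : realType) (U B : metricType R)
    (p : U -> B) (A A' : set U) (Z Z' : set B)
    (phi : U -> U) (theta : B -> B) : Prop :=
  [/\ bijective_isometry A A' phi, bijective_isometry Z Z' theta,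
      p @` A `<=` Z, p @` A' `<=` Z' &
      forall x : U, A x -> p (phi x) = theta (p x)].

Definition finite_double_matchings_extend (R : realType) (U B : metricType R)
    (p : U -> B) : Prop :=
  forall (A A' : set U) (Z Z' : set B) (phi : U -> U) (theta : B -> B),
    finite_set A -> finite_set A' -> finite_set Z -> finite_set Z' ->
    double_matching p A A' Z Z' phi theta ->
    exists (f : U -> U) (g : B -> B),
      [/\ double_automorphism p f g,
          forall x : U, A x -> f x = phi x &
          forall z : B, Z z -> g z = theta z].

(* Main.v *)
Require Import Defs.
From HB Require Import structures.
From mathcomp Require Import all_boot all_order all_algebra.
From mathcomp Require Import all_classical all_reals topology.
From mathcomp Require Import lra.

Set Implicit Arguments.
Unset Strict Implicit.
Unset Printing Implicit Defensive.

Import Order.TTheory GRing.Theory Num.Theory.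

Local Open Scope classical_set_scope.
Local Open Scope ring_scope.

(** Everything reduces to one condition on a field p : U -> B, here called
    [extension_property]: over any finite A in U, any Katetov function f
    (prescribed distances to a new point) and any b compatible with f are
    realized by a point u of the fibre of b.  It is the Urysohn condition with
    one-point extensions replaced by distance functions, so that a new point
    may coincide with an old one.

    Take a finite partial isometry between two Polish fields over B, commuting
    with the projections.  If the target has the extension property, it can be
    prolonged to one more point of the source; if the source has it, to one more
    point of the target.  Running through countable dense sets and passing to the completion
    gives the two consequences used below: a field with the extension property
    is universal (forth only, [extension_property_universal]), and finite
    partial isometries between two such fields extend to isomorphisms (back and
    forth, [extension_property_homogeneous]).  A Urysohn space is treated as a
    Urysohn field over a one-point space, so no separate argument is needed for
    B.

    An ultimate Urysohn field gives the Urysohn property of B by extending the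
    empty subset of U, and the Urysohn property of p by extending the finite
    set Z, the union of p(A) and {b}, which already contains all the values that are
    prescribed, by an auxiliary point.  Conversely, in a Urysohn field over a
    Urysohn space a finite double matching (phi, theta) extends: first theta
    extends to an isometry g of B, then phi is a partial isometry from the
    field g o p to the field p, both of which have the extension property.
    Finally, if p is strongly universal, Z* and then A* embed somewhere
    compatibly with p and q; homogeneity brings the copies of A and Z back to
    A and Z, which is the ultimate Urysohn property. *)

(** * Preliminaries on metric spaces *)

Lemma mdist0_eq (R : realType) (X : metricType R) (x y : X) :
  mdist x y <= 0 -> x = y.
Proof.
move=> d0; apply: mdist_positivity; apply/eqP.
by rewrite eq_le d0 mdist_ge0.
Qed.

Lemma dense_mdist (R : realType) (X : metricType R) (D : set X) :
  dense D -> forall (x : X) (e : R), 0 < e ->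
  exists2 y, D y & mdist x y < e.
Proof.
move=> dD x e e0.
have [] := dD (ball x e)°.
- by exists x; apply: nbhs_singleton; apply: nbhs_interior; exact: nbhsx_ballx.
- exact: open_interior.
- move=> y [/interior_subset]; rewrite ballEmdist /= => xy Dy.
  by exists y.
Qed.

(** Completeness: by compactness a Cauchy filter clusters somewhere, and it
    converges to any of its cluster points. *)
Lemma finite_polish (R : realType) (X : metricType R) :
  finite_set [set: X] -> polish X.
Proof.
move=> finX; split; last first.
  exists [set: X]; first exact: finite_set_countable.
  by move=> O [x Ox] _; exists x.
move=> F PF cF.
have [x [_ clx]] := finite_compact finX PF filterT.
exists x; apply/(@fcvg_ballP R) => e e0.
have e20 : 0 < e / 2 by rewrite divr_gt0.
have [|[D1 D2] /= [FD1 FD2] D12] :=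
    cF [set xy : X * X | ball xy.1 (e / 2) xy.2].
  by rewrite /= nbhs_simpl -entourage_ballE; exists (e / 2).
have [z [D1z xz]] := clx _ _ FD1 (nbhsx_ballx x (e / 2) e20).
near=> t; apply: (ball_split xz); apply: (D12 (z, t)); split => //=.
by near: t.
Unshelve. all: by end_near. Qed.

(** An alias of [unit] for each [R], to carry a distance with values in [R]. *)
Definition singleton_space (R : realType) : Type := unit.

HB.instance Definition _ (R : realType) :=
  Choice.copy (singleton_space R) unit.

Lemma singleton_space_positivity (R : realType) (x y : singleton_space R) :
  0 = 0 :> R -> x = y.
Proof. by case: x y => -[]. Qed.

HB.instance Definition _ (R : realType) :=
  @isMetric.Build R (singleton_space R) (fun _ _ => 0)
    (fun _ => erefl) (@singleton_space_positivity R) (fun _ _ => erefl)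
    (fun _ _ _ => ler_wpDr (lexx 0) (lexx 0)).

Lemma singleton_space_polish (R : realType) : polish (singleton_space R).
Proof.
by apply: finite_polish; apply: (sub_finite_set _ (finite_set1 tt)) => -[].
Qed.

(** * One-point extensions as Katetov functions *)

(** These are the conditions for f to be the distances from the points of A to
    one further point, which may belong to A. *)
Definition katetov (R : realType) (X : metricType R) (A : set X)
    (f : X -> R) : Prop :=
  forall x y, A x -> A y -> f x <= mdist x y + f y /\ mdist x y <= f x + f y.

Lemma katetov_mdist (R : realType) (X : metricType R) (A : set X) (a : X) :
  katetov A (mdist^~ a).
Proof.
move=> x y _ _; split; first exact: metric_triangle.
by rewrite /= (metric_sym y a); exact: metric_triangle.
Qed.

(** The proofs about f are arguments of this alias of [option A] so that its
    metric can be attached to it as a canonical structure; [None] is the new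
    point. *)
Definition katetov_space (R : realType) (X : metricType R) (A : set X)
    (f : X -> R) & katetov A f & (forall x, A x -> 0 < f x) : Type :=
  option A.

Section KatetovExtension.
Variables (R : realType) (X : metricType R) (A : set X) (f : X -> R).
Hypotheses (kf : katetov A f) (f_gt0 : forall x, A x -> 0 < f x).

Let dist (u v : option A) : R :=
  match u, v with
  | Some x, Some y => mdist (val x) (val y)
  | Some x, None => f (val x)
  | None, Some y => f (val y)
  | None, None => 0
  end.

Let distxx u : dist u u = 0.
Proof. by case: u => [x|] //=; rewrite mdistxx. Qed.

Let dist_positivity u v : dist u v = 0 -> u = v.
Proof.
case: u v => [x|] [y|] //= d0.
- by congr Some; apply: val_inj; exact: mdist_positivity.
- by have := f_gt0 (set_valP x); rewrite d0 ltxx.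
- by have := f_gt0 (set_valP y); rewrite d0 ltxx.
Qed.

Let dist_sym u v : dist u v = dist v u.
Proof. by case: u v => [x|] [y|] //=; rewrite metric_sym. Qed.

Let dist_triangle v u w : dist u w <= dist u v + dist v w.
Proof.
case: u v w => [x|] [y|] [z|] //=; rewrite ?add0r ?addr0 //.
- exact: metric_triangle.
- by have [] := kf (set_valP x) (set_valP y).
- by have [] := kf (set_valP x) (set_valP z).
- rewrite addrC metric_sym.
  by have [] := kf (set_valP z) (set_valP y).
- by rewrite addr_ge0 // ltW // f_gt0 //; exact: set_valP.
Qed.

HB.instance Definition _ := Choice.copy (katetov_space kf f_gt0) (option A).
HB.instance Definition _ :=
  @isMetric.Build R (katetov_space kf f_gt0) dist
    distxx dist_positivity dist_sym dist_triangle.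

(** This is transparent so that its points can be analysed as elements of
    [option A] and its distances computed. *)
Definition katetov_extension : one_point_extension A.
Proof.
apply: (@Build_one_point_extension R X A (katetov_space kf f_gt0)
  (Some : A -> katetov_space kf f_gt0) None).
- by [].
- by [].
- by case=> [x|]; [right; exists x | left].
Defined.

End KatetovExtension.


(** * The extension property and partial isometries of fields *)

Definition extension_property (R : realType) (U B : metricType R)
    (p : U -> B) : Prop :=
  forall (A : set U) (f : U -> R) (b : B), finite_set A -> katetov A f ->
    (forall x, A x -> mdist (p x) b <= f x) ->
    exists u, p u = b /\ forall x, A x -> mdist x u = f x.

(** If f vanishes at some a in A, the new point has to be a itself, and b is then
    p a; otherwise f is positive and defines a genuine one-point extension. *)
Lemma urysohn_field_extension_property (R : realType) (U B : metricType R)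
    (p : U -> B) : urysohn_field p -> extension_property p.
Proof.
move=> [[_ _ p1] ext] A f b finA kf pf.
have f_ge0 x : A x -> 0 <= f x.
  by move=> Ax; have [_] := kf x x Ax Ax; rewrite mdistxx; lra.
have [[a Aa fa0]|nA] := pselect (exists2 a, A a & f a = 0).
  exists a; split=> [|x Ax].
    by apply: mdist0_eq; rewrite -fa0; exact: pf.
  have [] := kf x a Ax Aa; rewrite fa0 !addr0 => h1 h2.
  by apply/eqP; rewrite eq_le h1 h2.
have f_gt0 x : A x -> 0 < f x.
  move=> Ax; rewrite lt_neqAle f_ge0// andbT; apply/eqP => fx.
  by apply: nA; exists x.
pose phi (e : katetov_extension kf f_gt0) : B :=
  if e is Some x then p (val x) else b.
have phi1 : one_lipschitz phi.
  move=> [x|] [y|] /=.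
  - exact: p1.
  - exact/pf/set_valP.
  - by rewrite metric_sym; exact/pf/set_valP.
  - by rewrite !mdistxx.
have [i [isoi iA pi]] := ext A (katetov_extension kf f_gt0) phi finA phi1
  (fun=> erefl).
exists (i None); split; first exact: (pi None).
move=> x Ax; pose a : A := SigSub (mem_set Ax).
have ia : i (Some a) = x := iA a.
by rewrite -{1}ia isoi.
Qed.

(** A graph rather than a function, so that the roles of X and Y can be
    exchanged and graphs can be enlarged and united freely. *)
Definition partial_iso (R : realType) (X Y B : metricType R)
    (p : X -> B) (q : Y -> B) (G : set (X * Y)) : Prop :=
  (forall s, G s -> q s.2 = p s.1) /\
  (forall s t, G s -> G t -> mdist s.2 t.2 = mdist s.1 t.1).

(** The distances that the image of x must have from the second coordinates of G
    are the distances of x from the first ones; they form a Katetov function, to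
    which the extension property of q applies over p x. *)
Lemma partial_iso_forth (R : realType) (X Y B : metricType R)
    (p : X -> B) (q : Y -> B) (G : set (X * Y)) (x : X) :
  one_lipschitz p -> extension_property q -> finite_set G ->
  partial_iso p q G -> exists y, partial_iso p q (G `|` [set (x, y)]).
Proof.
move=> p1 extq finG [Gpq Giso].
pose f y := xget 0 [set r | exists2 t, G t & t.2 = y /\ r = mdist t.1 x].
have fE t : G t -> f t.2 = mdist t.1 x.
  move=> Gt; apply: xget_unique; first by exists t.
  move=> r [s Gs [st ->]]; have /mdist0_eq -> // : mdist s.1 t.1 <= 0.
  by rewrite -Giso // st mdistxx.
have kf : katetov (snd @` G) f.
  move=> _ _ [s Gs <-] [t Gt <-]; rewrite !fE // Giso //.
  exact: (@katetov_mdist R X setT x s.1 t.1 I I).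
have [|y [qy dy]] := extq (snd @` G) f (p x) (finite_image _ finG) kf.
- by move=> _ [t Gt <-]; rewrite fE // Gpq //; exact: p1.
exists y; split=> [s [/Gpq //|-> //]|].
have dG t : G t -> mdist t.2 y = mdist t.1 x.
  by move=> Gt; rewrite dy ?fE //; exists t.
move=> s t [Gs|->] [Gt|->] /=; rewrite ?mdistxx //.
- exact: Giso.
- exact: dG.
- by rewrite metric_sym dG // metric_sym.
Qed.

Lemma partial_iso_swap (R : realType) (X Y B : metricType R)
    (p : X -> B) (q : Y -> B) (G : set (X * Y)) :
  partial_iso p q G -> partial_iso q p [set t | G (t.2, t.1)].
Proof.
move=> [Gpq Giso]; split=> [s /Gpq -> //|s t Gs Gt].
by rewrite -(Giso _ _ Gs Gt).
Qed.

Lemma partial_iso_back (R : realType) (X Y B : metricType R)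
    (p : X -> B) (q : Y -> B) (G : set (X * Y)) (y : Y) :
  one_lipschitz q -> extension_property p -> finite_set G ->
  partial_iso p q G -> exists x, partial_iso p q (G `|` [set (x, y)]).
Proof.
move=> q1 extp finG isoG.
have finG' : finite_set [set t : Y * X | G (t.2, t.1)].
  apply: sub_finite_set (finite_image (fun t => (t.2, t.1)) finG).
  by move=> [y' x'] /= Gxy; exists (x', y').
have [x /partial_iso_swap isoGx] :=
  partial_iso_forth y q1 extp finG' (partial_iso_swap isoG).
exists x; congr partial_iso: isoGx; apply/seteqP; split=> -[x' y'] /=.
  by move=> [|[-> ->]]; [left | right].
by move=> [|[-> ->]]; [left | right].
Qed.

(** The abstract back-and-forth argument: countably many requirements Q i, each
    of which can be met by adding one element to a good set, are met together by
    the union of an increasing chain of good sets.  As the union itself need not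
    be good, the conclusion only records that any two of its elements lie in a
    common good set, which suffices for properties that involve at most two
    elements at a time. *)
Lemma exhaustion (T I : Type) (D : set I) (Q : I -> set T)
    (P : set T -> Prop) (G0 : set T) :
  countable D -> P G0 ->
  (forall G i, P G -> D i -> exists t, Q i t /\ P (G `|` [set t])) ->
  exists G : set T,
    [/\ G0 `<=` G, forall i, D i -> exists t, G t /\ Q i t &
        forall s t, G s -> G t -> exists H, [/\ P H, H s & H t]].
Proof.
move=> /countable_injP[code] codeI P0 step.
(* Stage n deals with the index of code n, if there is one. *)
have next (Gn : {G : set T | P G} * nat) : exists G' : {G : set T | P G},
    sval Gn.1 `<=` sval G' /\
    forall i, D i -> code i = Gn.2 -> exists t, sval G' t /\ Q i t.
  case: Gn => -[G PG] n /=.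
  have [[i [Di in_]]|no] := pselect (exists i, D i /\ code i = n); last first.
    exists (exist _ G PG); split => // i Di in_.
    by case: no; exists i.
  have [t [Qt PGt]] := step G i PG Di.
  exists (exist _ _ PGt); split=> [|j Dj jn] /=; first exact: subsetUl.
  have <- : i = j by apply: codeI; rewrite ?inE // in_ jn.
  by exists t; split => //; right.
have [nxt nxtP] := choice next.
pose chain := fix chain n :=
  if n is m.+1 then nxt (chain m, m) else exist _ G0 P0.
have mono m n : (m <= n)%N -> sval (chain m) `<=` sval (chain n).
  move=> /subnKC <-; elim: (n - m)%N => [|k IH]; first by rewrite addn0.
  rewrite addnS; apply: (subset_trans IH).
  by have [] := nxtP (chain (m + k)%N, (m + k)%N).
exists (\bigcup_n sval (chain n)); split.
- by move=> t G0t; exists 0%N.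
- move=> i Di; have [_ /(_ i Di erefl)[t [Gt Qt]]] :=
    nxtP (chain (code i), code i).
  by exists t; split => //; exists (code i).+1.
- move=> s t [m _ Gs] [n _ Gt]; exists (sval (chain (maxn m n))); split.
  + exact: svalP.
  + by apply: mono Gs; exact: leq_maxl.
  + by apply: mono Gt; exact: leq_maxr.
Qed.

Lemma partial_iso_exhaustion (R : realType) (X Y B : metricType R)
    (p : X -> B) (q : Y -> B) (I : Type) (D : set I) (Q : I -> set (X * Y))
    (G0 : set (X * Y)) :
  countable D -> finite_set G0 -> partial_iso p q G0 ->
  (forall G i, finite_set G -> partial_iso p q G -> D i ->
     exists t, Q i t /\ partial_iso p q (G `|` [set t])) ->
  exists G, [/\ G0 `<=` G, partial_iso p q G &
                forall i, D i -> exists t, G t /\ Q i t].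
Proof.
move=> cD fin0 iso0 step.
have [||G [G0G DG GP]] := @exhaustion (X * Y) I D Q
  (fun G => finite_set G /\ partial_iso p q G) G0 cD.
- by [].
- move=> G i [finG isoG] Di; have [t [Qt isot]] := step G i finG isoG Di.
  by exists t; split => //; split => //; rewrite finite_setU.
exists G; split => //; split=> [s Gs|s t Gs Gt].
  by have [H [[_ [Hpq _]] Hs _]] := GP s s Gs Gs; exact: Hpq.
by have [H [[_ [_ Hiso]] Hs Ht]] := GP s t Gs Gt; exact: Hiso.
Qed.

(** * Completion of partial isometries *)

(** The filter generated by the images of the points of the domain close to x is
    Cauchy, and its limit l has the right distances by continuity.  These
    distances characterize l, so the limit need not be mentioned afterwards. *)
Lemma partial_iso_limit (R : realType) (X Y : metricType R)
    (G : set (X * Y)) (x : X) :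
  complete_space Y ->
  (forall s t, G s -> G t -> mdist s.2 t.2 = mdist s.1 t.1) ->
  (forall e, 0 < e -> exists2 t, G t & mdist x t.1 < e) ->
  exists l, forall t, G t -> mdist l t.2 = mdist x t.1.
Proof.
move=> cY Giso xG.
pose near_image (e : R) : set Y :=
  [set y | exists2 t, G t /\ mdist x t.1 < e & t.2 = y].
pose F : set_system Y := filter_from [set e : R | 0 < e] near_image.
have le_near e e' : e <= e' -> near_image e `<=` near_image e'.
  move=> ee' y [t [Gt xt] ty]; exists t => //; split=> //.
  exact: lt_le_trans xt ee'.
have FF : ProperFilter F.
  apply: filter_from_proper; last first.
    by move=> e /xG[t Gt xt]; exists t.2, t.
  apply: filter_from_filter; first by exists 1 => /=.
  move=> e e' /= e0 e'0; exists (Num.min e e'); first by rewrite /= lt_min e0.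
  by rewrite subsetI; split; apply: le_near; rewrite ge_min lexx ?orbT.
have [l Fl] : exists l : Y, F --> l.
  apply: (cY F FF); apply/cauchy_ballP => e e0.
  exists (near_image (e / 2), near_image (e / 2)) => /=.
    have e20 : 0 < e / 2 by lra.
    by split; exists (e / 2).
  move=> [_ _] /= [[s [Gs xs] <-] [t [Gt xt] <-]].
  rewrite ballEmdist /= Giso //.
  by have := metric_triangle s.1 x t.1; rewrite (metric_sym s.1 x); lra.
exists l => t Gt.
have close e : 0 < e ->
    exists s, [/\ G s, mdist x s.1 < e & mdist l s.2 < e].
  move=> e0; have [d /= d0 ball_near] : F (ball l e) by apply: Fl; exact: nbhsx_ballx.
  have [s Gs xs] := xG (Num.min d e) ltac:(by rewrite lt_min d0).
  move: xs; rewrite lt_min => /andP[xsd xse].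
  exists s; split => //.
  have : ball l e s.2 by apply: ball_near; exists s.
  by rewrite ballEmdist.
apply/eqP; rewrite eq_le; apply/andP; split.
- apply/ler_addgt0Pr => e e0.
  have [|s [Gs xs ls]] := close (e / 2); first by lra.
  have := metric_triangle l s.2 t.2; rewrite Giso //.
  by have := metric_triangle s.1 x t.1; rewrite (metric_sym s.1 x); lra.
- apply/ler_addgt0Pr => e e0.
  have [|s [Gs xs ls]] := close (e / 2); first by lra.
  have := metric_triangle x s.1 t.1; rewrite -Giso //.
  by have := metric_triangle s.2 l t.2; rewrite (metric_sym s.2 l); lra.
Qed.

(** The conclusion on distances says more than that F extends G: it locates F x
    for every x, which is what proves surjectivity when the range of G is also
    dense. *)
Lemma partial_iso_completion (R : realType) (X Y B : metricType R)
    (p : X -> B) (q : Y -> B) (G : set (X * Y)) :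
  complete_space Y -> one_lipschitz p -> one_lipschitz q ->
  partial_iso p q G ->
  (forall x e, 0 < e -> exists2 t, G t & mdist x t.1 < e) ->
  exists F : X -> Y,
    [/\ isometric_embedding F, forall x, q (F x) = p x &
        forall x t, G t -> mdist (F x) t.2 = mdist x t.1].
Proof.
move=> cY p1 q1 [Gpq Giso] domG.
have [F FG] := choice (fun x => partial_iso_limit cY Giso (domG x)).
exists F; split=> [x y|x|//].
- apply/eqP; rewrite eq_le; apply/andP; split; apply/ler_addgt0Pr => e e0;
    have [|t Gt xt] := domG x (e / 2); try lra;
    have := FG x t Gt; have := FG y t Gt.
  + have := metric_triangle (F x) t.2 (F y); rewrite (metric_sym t.2 (F y)).
    have := metric_triangle y x t.1; rewrite (metric_sym y x); lra.
  + have := metric_triangle (F y) (F x) t.2; rewrite (metric_sym (F y) (F x)).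
    have := metric_triangle x t.1 y; rewrite (metric_sym t.1 y); lra.
- apply: mdist0_eq; apply/ler_addgt0Pr => e e0.
  have [|t Gt xt] := domG x (e / 2); first by lra.
  have := metric_triangle (q (F x)) (q t.2) (p x); rewrite Gpq //.
  have := q1 (F x) t.2; rewrite FG // Gpq //.
  have := p1 t.1 x; rewrite (metric_sym t.1); lra.
Qed.

(** The requirements of a back-and-forth construction are indexed by the points of
    two dense sets. *)
Lemma countable_sum (S T : Type) (D : set S) (E : set T) :
  countable D -> countable E ->
  countable [set i : S + T | match i with inl x => D x | inr y => E y end].
Proof.
move=> /countable_injP[f fI] /countable_injP[g gI]; apply/countable_injP.
exists (fun i => match i with inl x => (f x).*2 | inr y => (g y).*2.+1 end).
move=> [x|y] [x'|y'] /set_mem /= Di /set_mem /= Di' eq_code.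
- by congr inl; apply: fI; rewrite ?inE //; exact: double_inj.
- by have := congr1 odd eq_code; rewrite /= !odd_double.
- by have := congr1 odd eq_code; rewrite /= !odd_double.
- by congr inr; apply: gI; rewrite ?inE //; case: eq_code => /double_inj.
Qed.

(** * Universality and homogeneity *)

(** The isometry is built point by point along a dense set of Y, then completed. *)
Lemma extension_property_universal (R : realType) (U B : metricType R)
    (p : U -> B) :
  is_field p -> extension_property p -> universal_field p.
Proof.
move=> fp extp; split=> // Y phi [[_ [D cD dD]] _ phi1].
have [[cU _] _ p1] := fp.
have [|//|G i finG isoG _|G [_ isoG DG]] :=
  @partial_iso_exhaustion R Y U B phi p Y D (fun y t => t.1 = y) set0 cD.
- exact: finite_set0.
- have [u isou] := partial_iso_forth i phi1 extp finG isoG.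
  by exists (i, u).
- have [|F [Fiso pF _]] := partial_iso_completion cU phi1 p1 isoG.
    move=> y e /(dense_mdist dD y)[z Dz yz].
    by have [t [Gt tz]] := DG z Dz; exists t; rewrite ?tz.
  by exists F.
Qed.

(** Back and forth along dense sets of both sides.  The completion F is onto
    because a point y has, by completeness of X, a counterpart x with the same
    distances to the graph, and F x is then as close to y as desired. *)
Lemma extension_property_homogeneous (R : realType) (X Y B : metricType R)
    (p : X -> B) (q : Y -> B) (G0 : set (X * Y)) :
  is_field p -> is_field q -> extension_property p -> extension_property q ->
  finite_set G0 -> partial_iso p q G0 ->
  exists F : X -> Y,
    [/\ bijective_isometry [set: X] [set: Y] F, forall x, q (F x) = p x &
        forall t, G0 t -> F t.1 = t.2].
Proof.
move=> [[cX [D cD dD]] _ p1] [[cY [E cE dE]] _ q1] extp extq finG0 isoG0.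
pose Q (i : X + Y) : set (X * Y) :=
  match i with inl x => [set t | t.1 = x] | inr y => [set t | t.2 = y] end.
have [G [x|y] finG isoG _|G [G0G isoG DG]] :=
  partial_iso_exhaustion (Q := Q) (countable_sum cD cE) finG0 isoG0.
- have [y isoGy] := partial_iso_forth x p1 extq finG isoG.
  by exists (x, y).
- have [x isoGx] := partial_iso_back y q1 extp finG isoG.
  by exists (x, y).
have domG x e : 0 < e -> exists2 t, G t & mdist x t.1 < e.
  move=> /(dense_mdist dD x)[z Dz xz].
  by have [t [Gt tz]] := DG (inl z) Dz; exists t; rewrite ?tz.
have ranG y e : 0 < e -> exists2 t, G t & mdist y t.2 < e.
  move=> /(dense_mdist dE y)[z Ez yz].
  by have [t [Gt tz]] := DG (inr z) Ez; exists t; rewrite ?tz.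
have [F [Fiso qF FG]] := partial_iso_completion cY p1 q1 isoG domG.
exists F; split=> //; last first.
  by move=> t /G0G Gt; apply: mdist0_eq; rewrite FG // mdistxx.
split; last by move=> x y _ _; exact: Fiso.
split=> [//|x y _ _ Fxy|y _].
  by apply: mdist0_eq; rewrite -Fiso Fxy mdistxx.
have [_ swap_iso] := partial_iso_swap isoG.
have [|x xG] := partial_iso_limit (x := y) cX swap_iso.
  by move=> e /(ranG y)[t Gt yt]; exists (t.2, t.1) => //=; case: t Gt yt.
exists x => //; apply: mdist0_eq; apply/ler_addgt0Pr => e e0.
have [|t Gt yt] := ranG y (e / 2); first by lra.
have := xG (t.2, t.1); rewrite /= -surjective_pairing => /(_ Gt) xt.
have := FG x t Gt.
have := metric_triangle (F x) t.2 y; rewrite (metric_sym t.2 y); lra.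
Qed.

Lemma bijective_isometry_extends (R : realType) (X Y B : metricType R)
    (p : X -> B) (q : Y -> B) (A : set X) (A' : set Y) (f : X -> Y) :
  is_field p -> is_field q -> extension_property p -> extension_property q ->
  finite_set A -> bijective_isometry A A' f ->
  (forall x, A x -> q (f x) = p x) ->
  exists F : X -> Y,
    [/\ bijective_isometry [set: X] [set: Y] F, forall x, q (F x) = p x &
        forall x, A x -> F x = f x].
Proof.
move=> fp fq extp extq finA [_ fiso] qf.
have [||F [Fbij qF FG]] := extension_property_homogeneous
    (G0 := (fun x => (x, f x)) @` A) fp fq extp extq.
- exact: finite_image.
- split=> [_ [x Ax <-]|_ _ [x Ax <-] [y Ay <-]] /=; first exact: qf.
  exact: fiso.
exists F; split=> // x Ax; apply: (FG (x, f x)).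
by exists x.
Qed.

(** * The Urysohn properties of p and B *)

Definition singleton_field (R : realType) (X : metricType R) :
  X -> singleton_space R := fun=> tt.

Lemma singleton_field_is_field (R : realType) (X : metricType R) :
  polish X -> is_field (@singleton_field R X).
Proof.
move=> polX; split=> //; first exact: singleton_space_polish.
by move=> x y; exact: mdist_ge0.
Qed.

(** Over a one-point base the conditions involving the base are void, so
    universality and homogeneity of fields become those of spaces. *)
Lemma urysohn_space_of_urysohn_field (R : realType) (X : metricType R) :
  urysohn_field (@singleton_field R X) -> urysohn_space X.
Proof.
move=> uX; have [fX _] := uX; have [polX _ _] := fX.
have extX := urysohn_field_extension_property uX.
split.
  split=> // Y polY.
  have [_ /(_ Y _ (singleton_field_is_field polY))[i [iso_i _]]] :=
    extension_property_universal fX extX.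
  by exists i.
move=> A A' f finA _ bijf.
have [//|g [gbij _ gf]] :=
  bijective_isometry_extends fX fX extX extX finA bijf.
by exists g.
Qed.

Definition singleton_extension (R : realType) (X : metricType R) :
  one_point_extension (set0 : set X).
Proof.
apply: (@Build_one_point_extension R X set0 (singleton_space R)
  (fun _ => tt) tt).
- by move=> x; case: (set_valP x).
- by move=> x; case: (set_valP x).
- by case; left.
Defined.

(** A one-point extension of Z is realized in B by letting the extension of the
    empty set of U map to its new point. *)
Lemma ultimate_urysohn_space (R : realType) (U B : metricType R)
    (p : U -> B) : ultimate_urysohn_field p -> urysohn_space B.
Proof.
move=> [[_ polB _] ult]; apply: urysohn_space_of_urysohn_field.
split; first exact: singleton_field_is_field.
move=> Z Zext phi finZ _ _.
have [|||i [j [_ jiso _ jZ _]]] :=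
  ult set0 Z (singleton_extension U) Zext (fun=> ext_point Zext)
    (finite_set0 _) finZ.
- by rewrite image_set0.
- by move=> x y; rewrite mdistxx mdist_ge0.
- by move=> x; case: (set_valP x).
- exists j; split=> // e.
  by case: (phi e); case: (singleton_field _).
Qed.

(** All values of phi lie in the finite union Z of p(A) and {b}, where b is the
    image of the new point.  The definition asks for a proper extension Z* of Z, so some
    auxiliary point, avoided by q, has to be supplied; as j is the inclusion on
    Z, the embedding i then lies over phi. *)
Lemma ultimate_urysohn_field_urysohn (R : realType) (U B : metricType R)
    (p : U -> B) : ultimate_urysohn_field p -> urysohn_field p.
Proof.
move=> [fp ult]; split=> // A Aext phi finA phi1 phiA.
set b := phi (ext_point Aext).
pose Z : set B := p @` A `|` [set b].
have Zphi e : Z (phi e).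
  have [->|[x ->]] := ext_cover e; first by right.
  by left; rewrite phiA; exists (val x) => //; exact: set_valP.
(* Adding 1 to a distance function keeps it Katetov and makes it positive. *)
pose f z : R := mdist z b + 1.
have kf : katetov Z f.
  move=> x y Zx Zy; have [] := katetov_mdist b Zx Zy.
  by rewrite /f /=; lra.
have f_gt0 z : Z z -> 0 < f z.
  by move=> _; have := mdist_ge0 z b; rewrite /f; lra.
pose Zext := katetov_extension kf f_gt0.
pose q (e : Aext) : Zext := ext_incl Zext (SigSub (mem_set (Zphi e))).
have [||||i [j [iiso _ iA jZ pi]]] := ult A Z Aext Zext q finA.
- by rewrite finite_setU; split; [exact: finite_image|exact: finite_set1].
- by move=> z [x Ax <-]; left; exists x.
- by move=> e e'; rewrite ext_inclE; exact: phi1.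
- by move=> x z zx; congr ext_incl; apply: val_inj; rewrite /= phiA zx.
by exists i; split=> // e; rewrite pi jZ.
Qed.

(** * Extension of double matchings *)

Lemma extension_property_isometry (R : realType) (U B : metricType R)
    (p : U -> B) (g : B -> B) :
  bijective_isometry [set: B] [set: B] g -> extension_property p ->
  extension_property (g \o p).
Proof.
move=> [[_ _ gsurj] giso] extp A f b finA kf pf.
have [b0 _ gb0] := gsurj b I.
have [|u [pu du]] := extp A f b0 finA kf.
  by move=> x Ax; rewrite -giso // gb0; exact: pf.
by exists u; split=> //=; rewrite pu.
Qed.

(** Once theta is extended to an isometry g of B, the relation p o phi = theta o p
    on A says that phi is a partial isometry from the field g o p to the field p. *)
Lemma urysohn_matchings_extend (R : realType) (U B : metricType R)
    (p : U -> B) :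
  urysohn_field p -> urysohn_space B -> finite_double_matchings_extend p.
Proof.
move=> up [_ homB] A A' Z Z' phi theta finA _ finZ finZ'.
move=> [bij_phi bij_theta pA _ p_phi].
have [g [gbij gE]] := homB Z Z' theta finZ finZ' bij_theta.
have extp := urysohn_field_extension_property up.
have [fp _] := up.
have fgp : is_field (g \o p).
  have [polU polB p1] := fp.
  by split=> // x y; rewrite /= gbij.2 //; exact: p1.
have [|F [Fbij pF FE]] := bijective_isometry_extends fgp fp
  (extension_property_isometry gbij extp) extp finA bij_phi.
  by move=> x Ax /=; rewrite p_phi // gE //; apply: pA; exists x.
by exists F, g; split.
Qed.

(** Families of points with the same mutual distances differ by an isometry between
    their ranges, which turns embedded copies into a matching. *)
Lemma isometric_copy (R : realType) (X : metricType R) (I : Type)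
    (f g : I -> X) :
  (forall s t, mdist (f s) (f t) = mdist (g s) (g t)) ->
  exists h : X -> X, bijective_isometry (range f) (range g) h /\
    forall s, h (f s) = g s.
Proof.
move=> fg.
have /choice[h hP] : forall x, exists y, forall s, f s = x -> y = g s.
  move=> x; have [[s sx]|no] := pselect (exists s, f s = x).
    exists (g s) => t tx; apply: mdist0_eq.
    by rewrite -fg sx tx mdistxx.
  by exists x => s sx; case: no; exists s.
have hE s : h (f s) = g s by exact: hP.
exists h; split=> //; split.
  split=> [_ [s _ <-]|x y /set_mem[s _ <-] /set_mem[t _ <-]|_ [s _ <-]].
  - by exists s.
  - by rewrite !hE => st; apply: mdist0_eq; rewrite fg st mdistxx.
  - by exists (f s); [exists s|].
by move=> _ _ [s _ <-] [t _ <-]; rewrite !hE fg.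
Qed.

Lemma finite_set_setT (T : Type) (A : set T) :
  finite_set A -> finite_set [set: A].
Proof. by rewrite (eq_finite_set (card_setT A)). Qed.

Lemma range_val (T : Type) (A : set T) : range (val : A -> T) = A.
Proof.
apply/seteqP; split=> [_ [x _ <-]|x Ax]; first exact: set_valP.
by exists (SigSub (mem_set Ax)).
Qed.

Lemma one_point_extension_finite (R : realType) (X : metricType R)
    (A : set X) (E : one_point_extension A) :
  finite_set A -> finite_set [set: E].
Proof.
move=> finA.
have : finite_set (ext_incl E @` [set: A] `|` [set ext_point E]).
  rewrite finite_setU; split=> //; apply: finite_image.
  exact: finite_set_setT.
apply: sub_finite_set => e _.
by have [->|[x ->]] := ext_cover e; [right|left; exists x].
Qed.

(** Universality embeds Z* in B by some j0 and A* in U by some i0 over j0 o q.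
    These send A and Z to the wrong place, but moving them back is a finite double
    matching (phi, theta); a double automorphism (f, g) extending it corrects
    the embeddings to f o i0 and g o j0. *)
Lemma matchings_extend_ultimate (R : realType) (U B : metricType R)
    (p : U -> B) :
  strongly_universal_field p -> finite_double_matchings_extend p ->
  ultimate_urysohn_field p.
Proof.
move=> [[fp univp] [_ univB]] ext; split=> // A Z Aext Zext q finA finZ pA q1 qE.
have polA := finite_polish (one_point_extension_finite Aext finA).
have polZ := finite_polish (one_point_extension_finite Zext finZ).
have [j0 j0iso] := univB Zext polZ.
have [|i0 [i0iso pi0]] := univp Aext (j0 \o q).
  split=> //; first by have [] := fp.
  by move=> e e'; rewrite /= j0iso; exact: q1.
have [phi []] :=
  @isometric_copy R U A (fun x => i0 (ext_incl Aext x)) val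
    (fun x y => etrans (i0iso _ _) (ext_inclE _ _ _)).
rewrite range_val => phi_bij phiE.
have [theta []] :=
  @isometric_copy R B Z (fun z => j0 (ext_incl Zext z)) val
    (fun x y => etrans (j0iso _ _) (ext_inclE _ _ _)).
rewrite range_val => theta_bij thetaE.
have pAZ (x : A) : exists z : Z, val z = p (val x).
  have Zpx : Z (p (val x)) by apply: pA; exists (val x) => //; exact: set_valP.
  by exists (SigSub (mem_set Zpx)).
have pi0A (x : A) (z : Z) : val z = p (val x) ->
    p (i0 (ext_incl Aext x)) = j0 (ext_incl Zext z).
  by move=> zx; rewrite pi0 /= (qE x z zx).
have matching : double_matching p (range (i0 \o ext_incl Aext)) A
    (range (j0 \o ext_incl Zext)) Z phi theta.
  split=> //.
  - move=> _ [_ [x _ <-] <-]; have [z zx] := pAZ x.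
    by exists z => //=; rewrite (pi0A x z zx).
  - move=> _ [x _ <-]; have [z zx] := pAZ x.
    by rewrite /= phiE (pi0A x z zx) thetaE.
have [f [g [[fbij gbij pfg] fE gE]]] := ext _ _ _ _ _ _
  (finite_image _ (finite_set_setT finA)) finA
  (finite_image _ (finite_set_setT finZ)) finZ matching.
exists (f \o i0), (g \o j0); split.
- by move=> x y; rewrite /= fbij.2.
- by move=> x y; rewrite /= gbij.2.
- by move=> x; rewrite /= fE ?phiE //; exists x.
- by move=> z; rewrite /= gE ?thetaE //; exists z.
- by move=> e; rewrite /= pfg pi0.
Qed.

Theorem theorem3p14 (R : realType) (U B : metricType R) (p : U -> B)
    (hp : is_field p) :
  [<-> ultimate_urysohn_field p;
       urysohn_field p /\ urysohn_space B;
       strongly_universal_field p /\ finite_double_matchings_extend p].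
Proof.
tfae.
- move=> ult; split; first exact: ultimate_urysohn_field_urysohn.
  exact: ultimate_urysohn_space ult.
- move=> [up uB]; split; last exact: urysohn_matchings_extend.
  split; last by have [] := uB.
  exact: extension_property_universal (urysohn_field_extension_property up).
- by move=> [univp ext]; exact: matchings_extend_ultimate.
Qed.
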